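(* Assuming $\exists^2$, the following are computationally equivalent: (1) any selection functional $\Omega_{C,w}$ for non-empty closed subsets of $[0,1]$, i.e. $\Omega_{C,w}(C)\in C$ for every non-empty closed $C\subseteq[0,1]$; (2) any functional $\Phi_{1,w}$ which on input an usco $f:[0,1]\to\mathbb{R}$ and the real $y=\sup_{x\in[0,1]}f(x)$ outputs $x\in[0,1]$ with $f(x)=y$; (3) any Cantor intersection functional. Moreover, assuming $\exists^2$, any Cantor intersection functional computes a weak Cantor realiser.
   Context: Computability is Kleene's higher-order computability (S1–S9), extended to partial functionals; ''computationally equivalent assuming $\exists^2$'' means each (any functional meeting one specification), together with $\exists^2$, computes some functional meeting the other. $\exists^2:\mathbb{N}^{\mathbb{N}}\to\{0,1\}$ satisfies $\exists^2(g)=0\leftrightarrow(\exists n)(g(n)=0)$. Sets of reals are given by characteristic functions; closed means complement open. $f$ is usco if $f(x_0)\ge\limsup_{x\to x_0}f(x)$ for all $x_0$. A Cantor intersection functional is any $\Phi$ such that for every sequence $(C_n)_{n\in\mathbb{N}}$ of non-empty closed sets with $C_{n+1}\subseteq C_n\subseteq[0,1]$ for all $n$, $\Phi(\lambda n.C_n)\in\bigcap_n C_n$. A weak Cantor realiser is defined for inputs $(A,Y)$ where $A\subseteq[0,1]$, $Y:\mathbb{R}\to\mathbb{N}$ is injective on $A$ and $(\forall n)(\exists x\in A)(Y(x)=n)$; its output is some real $x\in[0,1]\setminus A$. *)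

(* Defs.v *)
From mathcomp Require Import all_boot all_order all_algebra.
From mathcomp Require Import all_classical all_reals all_analysis.

Set Implicit Arguments.
Unset Strict Implicit.
Unset Printing Implicit Defensive.

Import Order.TTheory GRing.Theory Num.Theory.
Import numFieldNormedType.Exports.

Local Open Scope classical_set_scope.
Local Open Scope ring_scope.

(** * Kleene's S1-S9 over the finite types, with partial functionals *)

Inductive ty := ty0 | Arr of ty & ty.

Declare Scope ty_scope.
Delimit Scope ty_scope with ty.
Bind Scope ty_scope with ty.
Infix ":->" := Arr (at level 55, right associativity) : ty_scope.

Definition ty1 := (ty0 :-> ty0)%ty.
Definition ty2 := (ty1 :-> ty0)%ty.

Fixpoint tot (s : ty) : Type :=
  match s with ty0 => nat | Arr s t => tot s -> tot t end.

(* A partial functional of type s1 :-> ... :-> sn :-> ty0 takes TOTAL inputs,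
   as is usual for S1-S9; only its numerical value may be undefined ([None]). *)
Fixpoint par (s : ty) : Type :=
  match s with ty0 => option nat | Arr s t => tot s -> par t end.

Fixpoint par_of_tot (s : ty) : tot s -> par s :=
  match s with
  | ty0 => fun n => Some n
  | Arr s t => fun F x => par_of_tot (F x)
  end.

Definition arg := {s : ty & par s}.
Definition parg (s : ty) (F : par s) : arg := existT par s F.
Definition targ (s : ty) (x : tot s) : arg := parg (par_of_tot x).
Definition narg (n : nat) : arg := @targ ty0 n.

Definition index : seq nat -> nat := CodeSeq.code.
Arguments index : simpl never.

(* [kleene e a n] is {e}(a) = n.  Arguments of all types are kept in one list,
   so S6 moves an arbitrary argument to the front.  S8 is the finite-type form
   of Kleene's scheme: F = a_0, of type s1 :-> ... :-> sk :-> ty0, is applied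
   to the functionals lambda xi. {e_i}(xi, a), each of which must be total; for
   pure types k = 1 and this is Kleene's S8. *)
Inductive kleene : nat -> seq arg -> nat -> Prop :=
| S1 n b : kleene (index [:: 1%N]) (narg n :: b) n.+1
| S2 q b : kleene (index [:: 2%N; q]) b q
| S3 n b : kleene (index [:: 3%N]) (narg n :: b) n
| S4 g h b m n : kleene h b m -> kleene g (narg m :: b) n ->
    kleene (index [:: 4%N; g; h]) b n
| S5_0 g h b n : kleene g b n ->
    kleene (index [:: 5%N; g; h]) (narg 0 :: b) n
| S5_S g h b k m n :
    kleene (index [:: 5%N; g; h]) (narg k :: b) m ->
    kleene h (narg k :: narg m :: b) n ->
    kleene (index [:: 5%N; g; h]) (narg k.+1 :: b) n
| S6 g b1 x b2 n : kleene g (x :: b1 ++ b2) n ->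
    kleene (index [:: 6%N; size b1; g]) (b1 ++ x :: b2) n
| S7 (F : par ty1) k b n : F k = Some n ->
    kleene (index [:: 7%N]) (parg F :: narg k :: b) n
| S8 s (F : par s) es b n : kleene_app F es (parg F :: b) n ->
    kleene (index (8%N :: es)) (parg F :: b) n
| S9 e b c n : kleene e b n ->
    kleene (index [:: 9%N; size b]) (narg e :: b ++ c) n
(* [kleene_app F es a n]: F(x1,..,xk) = n where x_i = lambda xi. {e_i}(xi, a) *)
with kleene_app : forall s, par s -> seq nat -> seq arg -> nat -> Prop :=
| app_nil a n : @kleene_app ty0 (Some n) [::] a n
| app_cons s t (F : par (s :-> t)) e es (x : tot s) a n :
    kleene_lam e x a -> kleene_app (F x) es a n ->
    kleene_app F (e :: es) a n
(* [kleene_lam e x a]: x is the total functional lambda xi. {e}(xi, a), with the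
   last bound variable in front *)
with kleene_lam : nat -> forall s, tot s -> seq arg -> Prop :=
| lam_0 e n a : kleene e a n -> @kleene_lam e ty0 n a
| lam_Arr e s t (F : tot (s :-> t)) a :
    (forall x : tot s, kleene_lam e (F x) (targ x :: a)) -> kleene_lam e F a.

Fixpoint computed_by (e : nat) (s : ty) : par s -> seq arg -> Prop :=
  match s with
  | ty0 => fun v a => forall n, v = Some n <-> kleene e a n
  | Arr s t => fun F a => forall x : tot s, computed_by e (F x) (targ x :: a)
  end.

Definition computable_in (s : ty) (G : par s) (a : seq arg) : Prop :=
  exists e, computed_by e G a.

Definition E2 : tot ty2 :=
  fun g => if `[< exists n, g n = 0%N >] then 0%N else 1%N.

Definition computes_assuming_E2 (s t : ty) (P : par s -> Prop)
    (Q : par t -> Prop) : Prop :=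
  forall F, P F -> exists G, Q G /\ computable_in G [:: parg F; targ E2].

Definition equivalent_assuming_E2 (s t : ty) (P : par s -> Prop)
    (Q : par t -> Prop) : Prop :=
  computes_assuming_E2 P Q /\ computes_assuming_E2 Q P.

(** * Reals, sets of reals and functions as objects of finite type *)

(* n = 2^a 3^b 5^c ... codes (a - b) / (c + 1); every rational has a code. *)
Definition rat_of_code (n : nat) : rat :=
  ((logn 2 n)%:R - (logn 3 n)%:R) / (logn 5 n).+1%:R.

Definition I01 (R : realType) : set R := `[0, 1]%classic.

Section Coding.
Variable R : realType.
Implicit Types (x : R) (C : set R).

Definition fast_cauchy (a : tot ty1) : Prop :=
  forall n k,
    `|rat_of_code (a n) - rat_of_code (a (n + k)%N)| < 2%:R ^- n :> rat.

Definition codes_real (a : tot ty1) x : Prop :=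
  fast_cauchy a /\ (fun n => ratr (rat_of_code (a n)) : R) @ \oo --> x.

(* As for all functionals on reals below, only the values on codes matter. *)
Definition codes_set (c : tot ty2) C : Prop :=
  forall a x, codes_real a x -> c a = if `[< C x >] then 1%N else 0%N.

Definition codes_fun01 (p : tot (ty1 :-> ty1)) (f : R -> R) : Prop :=
  forall a x, I01 x -> codes_real a x -> codes_real (p a) (f x).

Definition codes_fun_nat (p : tot ty2) (Y : R -> nat) : Prop :=
  forall a x, codes_real a x -> p a = Y x.

Definition outputs (v : par ty1) x : Prop :=
  exists a : tot ty1, codes_real a x /\ forall n, v n = Some (a n).

(* f is only considered on [0, 1] *)
Definition usco01 (f : R -> R) : Prop :=
  forall x0, I01 x0 ->
    (limf_esup (EFin \o f) (within (@I01 R) x0^') <= (f x0)%:E)%E.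

(** * The specifications *)

(* Each functional induces a well-defined map (w below) on the sets, functions
   and reals coded by its inputs, and the specification constrains this map. *)

Definition closed_selection (Omega : par (ty2 :-> ty1)) : Prop :=
  exists w : set R -> R, forall C c,
    closed C -> C `<=` @I01 R -> C !=set0 -> codes_set c C ->
    C (w C) /\ outputs (Omega c) (w C).

Definition usco_maximiser (Phi : par ((ty1 :-> ty1) :-> ty1 :-> ty1)) : Prop :=
  exists w : (R -> R) -> R -> R, forall f y p b,
    usco01 f -> y = sup (f @` @I01 R) ->
    codes_fun01 p f -> codes_real b y ->
    [/\ I01 (w f y), f (w f y) = y & outputs (Phi p b) (w f y)].

Definition cantor_intersection (Phi : par ((ty0 :-> ty2) :-> ty1)) : Prop :=
  exists w : (nat -> set R) -> R,
  forall (C : nat -> set R) (c : tot (ty0 :-> ty2)),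
    (forall n, [/\ closed (C n), C n !=set0, C n.+1 `<=` C n &
                   C n `<=` @I01 R]) ->
    (forall n, codes_set (c n) (C n)) ->
    (\bigcap_n C n) (w C) /\ outputs (Phi c) (w C).

Definition weak_cantor_realiser (Phi : par (ty2 :-> ty2 :-> ty1)) : Prop :=
  exists w : set R -> (R -> nat) -> R, forall A Y c p,
    A `<=` @I01 R -> {in A &, injective Y} ->
    (forall n, exists2 x, A x & Y x = n) ->
    codes_set c A -> codes_fun_nat p Y ->
    [/\ I01 (w A Y), ~ A (w A Y) & outputs (Phi c p) (w A Y)].

End Coding.

(* Main.v *)
Require Import Defs.
From mathcomp Require Import all_boot all_order all_algebra.
From mathcomp Require Import all_classical all_reals all_analysis.
From mathcomp Require Import lra ring.
From Stdlib Require Import Eqdep_dec.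
Import Defs.

(** The usco and Cantor specifications reduce to and from closed selection by
    direct substitutions: an usco f is traded for its superlevel set
    {f >= sup f}, a closed set for its indicator (whose supremum is 1), a nested
    sequence for its intersection, and a closed set for a constant sequence.
    All characteristic functions involved are arithmetical in the inputs, hence
    computable from [E2].

    For the weak Cantor realiser, the fibre {x in A | Y x = n} is a singleton
    with computable characteristic function, so the Cantor intersection
    functional applied to the corresponding constant sequence enumerates A.
    Diagonalising needs only exact comparisons of reals with rationals, decided
    by [E2], so the resulting real does not depend on the codes of the inputs.

    S1-S9 is single-valued, so every index defines a partial functional of each
    type, and it is enough to exhibit an index with the right values on the
    inputs admitted by the specification. *)

Set Implicit Arguments.
Unset Strict Implicit.
Unset Printing Implicit Defensive.

(** * Kleene computations are single-valued *)

Scheme kleene_mind := Induction for kleene Sort Prop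
  with kleene_app_mind := Induction for kleene_app Sort Prop
  with kleene_lam_mind := Induction for kleene_lam Sort Prop.

Lemma ty_eq_dec (s t : ty) : {s = t} + {s <> t}.
Proof. by decide equality. Qed.

Lemma parg_inj (s : ty) : injective (@parg s).
Proof. move=> F G; exact: (inj_pair2_eq_dec _ ty_eq_dec). Qed.

Lemma narg_inj : injective narg.
Proof. by move=> m n /parg_inj[]. Qed.

(** The conclusion is a match on the type index, which avoids equations between dependent pairs. *)
Lemma kleene_app_inv s (F : par s) es a n : kleene_app F es a n ->
  match s return par s -> Prop with
  | ty0 => fun v => v = Some n
  | Arr s t => fun F => exists e es' (x : tot s),
      [/\ es = e :: es', kleene_lam e x a & kleene_app (F x) es' a n]
  end F.
Proof. by case=> // s' t F' e es' x a' n' ? ?; exists e, es', x. Qed.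

Lemma kleene_lam_inv e s (x : tot s) a : kleene_lam e x a ->
  match s return tot s -> Prop with
  | ty0 => fun n => kleene e a n
  | Arr s t => fun F => forall x : tot s, kleene_lam e (F x) (targ x :: a)
  end x.
Proof. by case. Qed.

(** Inversion of [kleene] goes through the decoded index: its first entry tells which scheme was
    applied last. *)
Definition kleene_step (es : seq nat) (a : seq arg) (n : nat) : Prop :=
  match es with
  | [:: 1] => exists m b, a = narg m :: b /\ n = m.+1
  | [:: 2; q] => n = q
  | [:: 3] => exists m b, a = narg m :: b /\ n = m
  | [:: 4; g; h] => exists m, kleene h a m /\ kleene g (narg m :: a) n
  | [:: 5; g; h] => exists k b, a = narg k :: b /\
      match k with
      | 0 => kleene g b n
      | k.+1 => exists m, kleene (index [:: 5; g; h]) (narg k :: b) m /\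
                  kleene h (narg k :: narg m :: b) n
      end
  | [:: 6; k; g] => exists b1 x b2,
      [/\ a = b1 ++ x :: b2, size b1 = k & kleene g (x :: b1 ++ b2) n]
  | [:: 7] => exists (F : par ty1) k b,
      a = parg F :: narg k :: b /\ F k = Some n
  | 8 :: es => exists s (F : par s) b,
      a = parg F :: b /\ kleene_app F es a n
  | [:: 9; k] => exists e b c,
      [/\ a = narg e :: b ++ c, size b = k & kleene e b n]
  | _ => False
  end.

Lemma kleene_inv e a n : kleene e a n -> kleene_step (CodeSeq.decode e) a n.
Proof.
by case=> * ; rewrite CodeSeq.codeK /=; repeat (eassumption || eexists).
Qed.

Lemma cat_cons_inj T (b1 b1' : seq T) x x' b2 b2' :
  size b1 = size b1' -> b1 ++ x :: b2 = b1' ++ x' :: b2' ->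
  [/\ b1 = b1', x = x' & b2 = b2'].
Proof.
move=> sb H; have: b1 = b1'.
  by rewrite -(take_size_cat (x :: b2) (erefl (size b1))) H take_size_cat.
move=> E; move: H; rewrite E => H.
have := congr1 (drop (size b1')) H.
by rewrite !drop_size_cat // => -[-> ->].
Qed.

Lemma cat_inj T (b b' c c' : seq T) :
  size b = size b' -> b ++ c = b' ++ c' -> b = b'.
Proof.
by move=> sb H; rewrite -(take_size_cat c (erefl (size b))) H take_size_cat.
Qed.

Lemma narg_cons_inj m n (a b : seq arg) :
  narg m :: a = narg n :: b -> m = n /\ a = b.
Proof.
by move=> H; split; [apply: narg_inj; exact: (congr1 (head (narg 0)) H)
                   | exact: (congr1 behead H)].
Qed.

Lemma parg_cons_inj s (F F' : par s) (a b : seq arg) :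
  parg F :: a = parg F' :: b -> F = F' /\ a = b.
Proof.
by move=> H; split; [apply: parg_inj; exact: (congr1 (head (narg 0)) H)
                   | exact: (congr1 behead H)].
Qed.

(** Simultaneous induction: the index fixes the last scheme, and in S8 the functionals fed to [F]
    are fixed, by extensionality, because their values are. *)
Lemma kleene_inj e a n m : kleene e a n -> kleene e a m -> n = m.
Proof.
move=> H; move: m.
pose P e a n (_ : kleene e a n) := forall m, kleene e a m -> n = m.
pose P0 s F es a n (_ : @kleene_app s F es a n) :=
  forall m, kleene_app F es a m -> n = m.
pose P1 e s x a (_ : @kleene_lam e s x a) :=
  forall y : tot s, kleene_lam e y a -> x = y.
apply: (@kleene_mind P P0 P1) H; rewrite /P /P0 /P1 {P P0 P1}.
- move=> n0 b m /kleene_inv; rewrite CodeSeq.codeK.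
  by move=> [k [c [/narg_cons_inj[-> _] ->]]].
- by move=> q b m /kleene_inv; rewrite CodeSeq.codeK => ->.
- move=> n0 b m /kleene_inv; rewrite CodeSeq.codeK.
  by move=> [k [c [/narg_cons_inj[-> _] ->]]].
- move=> g h b m n0 _ IHh _ IHg m' /kleene_inv; rewrite CodeSeq.codeK.
  by move=> [k [/IHh <- /IHg]].
- move=> g h b n0 _ IH m /kleene_inv; rewrite CodeSeq.codeK.
  by move=> [k [c [/narg_cons_inj[<- <-]]]]; apply: IH.
- move=> g h b k m n0 _ IHm _ IHn m' /kleene_inv; rewrite CodeSeq.codeK.
  by move=> [k' [c [/narg_cons_inj[<- <-]]]] [j [/IHm <- /IHn]].
- move=> g b1 x b2 n0 _ IH m /kleene_inv; rewrite CodeSeq.codeK.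
  by move=> [c1 [y [c2 [+ /esym sc]]]] => /(cat_cons_inj sc) [<- <- <-] /IH.
- move=> F k b n0 Fk m /kleene_inv; rewrite CodeSeq.codeK.
  move=> [F' [k' [b' [/parg_cons_inj[<- /narg_cons_inj[<- _]]]]]].
  by rewrite Fk => -[].
- move=> s F es b n0 _ IH m /kleene_inv; rewrite CodeSeq.codeK.
  (* The type of the functional in S8 is recovered from the tag of the first argument. *)
  move=> [s' [F' [b' [E]]]]; have FE : s = s'.
    exact: (congr1 (fun a => tag (head (narg 0) a)) E).
  by case: s' / FE F' E => F' /parg_cons_inj[<- _] /IH.
- move=> e0 b c n0 _ IH m /kleene_inv; rewrite CodeSeq.codeK.
  move=> [e' [b' [c' [/narg_cons_inj[<- H] /esym sb]]]].
  by rewrite -(cat_inj sb H) => /IH.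
- by move=> a0 n0 m /kleene_app_inv [].
- move=> s t F e0 es x a0 n0 _ IHx _ IHF m /kleene_app_inv.
  by move=> [e' [es' [x' [[<- <-] /IHx <- /IHF]]]].
- by move=> e0 n0 a0 _ IH y /kleene_lam_inv /IH.
- by move=> e0 s t F a0 _ IH y /kleene_lam_inv H; apply/funext => x; exact: IH.
Qed.

(** * Programs with named variables *)

(** Single-valuedness leaves at most one value at type 0, with [None] for divergence; choice over
    the total arguments assembles these values into a functional. *)
Lemma computed_by_exists s e a : exists G : par s, computed_by e G a.
Proof.
elim: s a => [|s _ t IH] a /=.
  have [[n Hn]|none] := pselect (exists n, kleene e a n).
    by exists (Some n) => m; split=> [[<-]|/(kleene_inj Hn) ->].
  by exists None => m; split=> // Hm; case: none; exists m.
by have [G HG] := choice (fun x : tot s => IH (targ x :: a)); exists G.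
Qed.

Lemma computes_assuming_E2_intro s t (P : par s -> Prop) (Q : par t -> Prop) :
  (forall F, P F -> exists e, forall G,
     computed_by e G [:: parg F; targ E2] -> Q G) ->
  computes_assuming_E2 P Q.
Proof.
move=> H F /H[e He]; have [G HG] := computed_by_exists t e [:: parg F; targ E2].
by exists G; split; [exact: He | exists e].
Qed.

(* A world is an argument list whose entries are labelled by variable names, so
   that programs survive the reordering of arguments by S6. *)
Definition world := seq (nat * arg).

Fixpoint look (w : world) (x : nat) : option arg :=
  if w is (y, v) :: w' then if y == x then Some v else look w' x else None.

Definition wf (w : world) := all (fun p => p.1 < size w) w.

Definition ext (w w' : world) :=
  forall x v, look w x = Some v -> look w' x = Some v.

Lemma ext_refl w : ext w w. Proof. by []. Qed.

Lemma ext_trans w1 w2 w3 : ext w1 w2 -> ext w2 w3 -> ext w1 w3.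
Proof. by move=> H12 H23 x v /H12/H23. Qed.

Lemma look_lt w x v n : all (fun p => p.1 < n) w -> look w x = Some v -> x < n.
Proof.
elim: w => //= -[y u] w IH /andP[/= yn /IH{}IH].
by case: eqP => [<-|_ /IH].
Qed.

Definition fresh (w : world) v : world := (size w, v) :: w.

Lemma wf_fresh w v : wf w -> wf (fresh w v).
Proof.
move=> ww; rewrite /wf /= ltnSn /=; apply: sub_all ww => p /=.
by move/ltn_trans; apply.
Qed.

Lemma ext_fresh w v : wf w -> ext w (fresh w v).
Proof.
by move=> ww x u Hx /=; case: eqP => // E; move: (look_lt ww Hx); rewrite E ltnn.
Qed.

Lemma look_fresh w v : look (fresh w v) (size w) = Some v.
Proof. by rewrite /= eqxx. Qed.

(* A program produces an index from the current list of variable names. *)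
Definition prog := seq nat -> nat.

(* Quantifying over the extensions of w makes weakening hold by definition;
   fresh names being sizes, no capture can occur. *)
Definition ev (w : world) (t : prog) (n : nat) :=
  forall w', wf w' -> ext w w' -> kleene (t (unzip1 w')) (unzip2 w') n.

Lemma ev_ext w w' t n : ext w w' -> ev w t n -> ev w' t n.
Proof. by move=> ww' H w2 wf2 e2; apply: H => //; exact: ext_trans e2. Qed.

(** S6 at the current position of [x]; the body is then compiled against the permuted list of
    names. *)
Definition pfront (x : nat) (t : prog) : prog := fun L =>
  let i := seq.index x L in
  index [:: 6; i; t (x :: take i L ++ drop i.+1 L)].

Lemma look_cat w1 w2 x :
  look (w1 ++ w2) x = if look w1 x is Some v then Some v else look w2 x.
Proof. by elim: w1 => //= -[y v] w1 IH; case: eqP. Qed.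

Lemma look_split w x v : look w x = Some v ->
  exists w1 w2, [/\ w = w1 ++ (x, v) :: w2, look w1 x = None &
    seq.index x (unzip1 w) = size w1].
Proof.
elim: w => //= -[y u] w IH; case: eqP => [-> [->]|yx /IH[w1 [w2 [-> H1 ->]]]].
  by exists [::], w; split.
by exists ((y, u) :: w1), w2; split => //=; case: eqP.
Qed.

(** The entry moved is the first one named [x], so no lookup changes and the permuted world still
    extends [w]. *)
Lemma kleene_front w x v (t : prog) n : wf w -> look w x = Some v ->
  (forall w', wf ((x, v) :: w') -> ext w ((x, v) :: w') ->
    kleene (t (x :: unzip1 w')) (v :: unzip2 w') n) ->
  kleene (pfront x t (unzip1 w)) (unzip2 w) n.
Proof.
move=> ww Hx; have [w1 [w2 [E H1 Hi]]] := look_split Hx => H.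
rewrite /pfront Hi E /unzip2 map_cat /= /unzip1 map_cat /=.
rewrite -(size_map snd w1) -/(unzip2 w1) -/(unzip1 w1).
rewrite -/(unzip2 w2) -/(unzip1 w2).
have -> : take (size (unzip2 w1)) (unzip1 w1 ++ x :: unzip1 w2) = unzip1 w1.
  by rewrite take_size_cat // !size_map.
have -> : drop (size (unzip2 w1)).+1 (unzip1 w1 ++ x :: unzip1 w2) = unzip1 w2.
  by rewrite -cat_rcons drop_size_cat // size_rcons !size_map.
apply: S6; have := H (w1 ++ w2); rewrite /unzip1 /unzip2 !map_cat; apply.
  have sE : size w = size ((x, v) :: w1 ++ w2).
    by rewrite E !size_cat /= size_cat addnS.
  move: ww; rewrite /wf {}sE E !all_cat /= all_cat.
  by case/and3P => -> -> ->.
move=> y u; rewrite E !look_cat /= look_cat.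
by case: eqP => // <-; rewrite H1.
Qed.

Definition pvar (x : nat) : prog := pfront x (fun _ => index [:: 3]).

Lemma ev_var w x n : look w x = Some (narg n) -> ev w (pvar x) n.
Proof.
move=> Hx w' ww e; apply: kleene_front => //; first exact: e Hx.
by move=> w2 _ _; exact: S3.
Qed.

Definition pconst (q : nat) : prog := fun _ => index [:: 2; q].

Lemma ev_const w q : ev w (pconst q) q.
Proof. by move=> w' _ _; exact: S2. Qed.

Definition psucc (t : prog) : prog := fun L => index [:: 4; index [:: 1]; t L].

Lemma ev_succ w t n : ev w t n -> ev w (psucc t) n.+1.
Proof. by move=> H w' ww e; apply: S4 (H _ ww e) _; exact: S1. Qed.

(** S5 puts the counter before the previous value, so in [h] the name [x] is the counter and [y] the
    previous value. *)
Definition prec (t g : prog) (h : nat -> nat -> prog) : prog := fun L =>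
  let y := size L in let x := y.+1 in
  index [:: 4; index [:: 5; g L; h x y (x :: y :: L)]; t L].

Lemma ev_rec w t g h k (f : nat -> nat) :
  ev w t k -> ev w g (f 0) ->
  (forall i x y w', ext w w' ->
    look w' x = Some (narg i) -> look w' y = Some (narg (f i)) ->
    ev w' (h x y) (f i.+1)) ->
  ev w (prec t g h) (f k).
Proof.
move=> Ht Hg Hh w' ww e; apply: S4 (Ht _ ww e) _.
elim: k {Ht} => [|k IH]; first by apply: S5_0; exact: Hg.
apply: S5_S IH _; rewrite size_map.
pose w1 := fresh w' (narg (f k)).
have ww1 : wf w1 by exact: wf_fresh.
pose w2 := fresh w1 (narg k).
have H2 : ev w2 (h (size w1) (size w')) (f k.+1).
  apply: Hh.
  - by apply: ext_trans e _; apply: ext_trans (ext_fresh _ ww1); exact: ext_fresh.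
  - exact: look_fresh.
  - by apply: (ext_fresh _ ww1); exact: look_fresh.
by apply: (H2 w2) (@ext_refl _); exact: wf_fresh.
Qed.

(* Higher-order abstract syntax for the functionals lambda xi. {e}(xi, a) of S8 *)
Fixpoint binder (s : ty) : Type :=
  match s with ty0 => prog | Arr _ t => nat -> binder t end.

Fixpoint plam (s : ty) : binder s -> prog :=
  match s with
  | ty0 => fun u => u
  | Arr _ t => fun u L => plam (u (size L)) (size L :: L)
  end.

(** A Kripke logical relation over the extensions of worlds. *)
Fixpoint evl (w : world) (s : ty) : binder s -> tot s -> Prop :=
  match s with
  | ty0 => fun u n => ev w u n
  | Arr s t => fun u F => forall (v : tot s) y w', ext w w' ->
      look w' y = Some (targ v) -> evl w' (u y) (F v)
  end.

Lemma kleene_plam w s (u : binder s) (x : tot s) w' : wf w' -> ext w w' ->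
  evl w u x -> kleene_lam (plam u (unzip1 w')) x (unzip2 w').
Proof.
elim: s u x w w' => [|s _ t IH] u x w w' ww' e /= H.
  by apply: lam_0; exact: H.
apply: lam_Arr => v; rewrite size_map.
pose w1 := fresh w' (targ v).
apply: (IH _ _ w1 w1) (@ext_refl _) _; first exact: wf_fresh.
by apply: H; [apply: ext_trans e _; exact: ext_fresh | exact: look_fresh].
Qed.

Fixpoint args (s : ty) : Type :=
  match s with ty0 => unit | Arr s t => binder s * args t end.

Fixpoint pargs (s : ty) : args s -> seq nat -> seq nat :=
  match s with
  | ty0 => fun _ _ => [::]
  | Arr s t => fun ar L => plam ar.1 L :: pargs ar.2 L
  end.

Fixpoint evargs (w : world) (s : ty) : par s -> args s -> nat -> Prop :=
  match s with
  | ty0 => fun v _ n => v = Some n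
  | Arr s t => fun F ar n => exists x, evl w ar.1 x /\ evargs w (F x) ar.2 n
  end.

Lemma kleene_pargs w s (F : par s) (ar : args s) n w' : wf w' -> ext w w' ->
  evargs w F ar n -> kleene_app F (pargs ar (unzip1 w')) (unzip2 w') n.
Proof.
move=> ww' e; elim: s F ar => [|s _ t IH] F ar /=; first by move=> ->; exact: app_nil.
by move=> [x [Hx /IH]]; apply: app_cons; exact: kleene_plam Hx.
Qed.

Definition pcall (s : ty) (f : nat) (ar : args s) : prog :=
  pfront f (fun L => index (8 :: pargs ar L)).

Lemma ev_call w s f (F : par s) (ar : args s) n :
  look w f = Some (parg F) -> evargs w F ar n -> ev w (pcall f ar) n.
Proof.
move=> Hf H w' ww' e; apply: kleene_front => //; first exact: e Hf.
move=> w2 ww2 e2; apply: S8.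
exact: (@kleene_pargs w s F ar n ((f, parg F) :: w2) ww2 (ext_trans e e2)).
Qed.

(** * Programs for arithmetic, valuations and comparison of coded reals *)

Definition padd t u : prog := prec t u (fun _ m => psucc (pvar m)).

Lemma ev_add w t u m n : ev w t m -> ev w u n -> ev w (padd t u) (m + n).
Proof.
move=> Ht Hu; apply: (ev_rec (f := fun i => i + n)) => // i x y w' e _ Hy.
by apply: ev_succ; exact: ev_var.
Qed.

Definition pmul t u : prog := prec t (pconst 0) (fun _ m => padd u (pvar m)).

Lemma ev_mul w t u m n : ev w t m -> ev w u n -> ev w (pmul t u) (m * n).
Proof.
move=> Ht Hu; apply: (ev_rec (f := fun i => i * n)) => //; first exact: ev_const.
by move=> i x y w' e _ Hy; apply: ev_add; [exact: ev_ext Hu | exact: ev_var].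
Qed.

(** The inner recursion is the predecessor: it returns its counter. *)
Definition psub t u : prog :=
  prec u t (fun _ m => prec (pvar m) (pconst 0) (fun k _ => pvar k)).

Lemma ev_sub w t u m n : ev w t m -> ev w u n -> ev w (psub t u) (m - n).
Proof.
move=> Ht Hu; apply: (ev_rec (f := fun i => m - i)) => //; first by rewrite subn0.
move=> i x y w' _ _ Hy; rewrite subnS.
apply: (ev_rec (f := predn)); [exact: ev_var | exact: ev_const |].
by move=> j a b w2 _ Ha _; exact: ev_var.
Qed.

Definition pexp t u : prog := prec u (pconst 1) (fun _ m => pmul t (pvar m)).

Lemma ev_exp w t u m n : ev w t m -> ev w u n -> ev w (pexp t u) (m ^ n).
Proof.
move=> Ht Hu; apply: (ev_rec (f := fun i => m ^ i)) => //; first exact: ev_const.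
move=> i x y w' e _ Hy; rewrite expnS.
by apply: ev_mul; [exact: ev_ext Ht | exact: ev_var].
Qed.

Definition pE2 (u : nat -> prog) : prog := @pcall ty2 0 (u, tt).

(* [pE2] refers to E2 by the name 0, as E2 always comes last in the input. *)
Definition has_E2 (w : world) := look w 0 = Some (targ E2).

Lemma ev_E2 w u (g : nat -> nat) : has_E2 w ->
  (forall k y w', ext w w' -> look w' y = Some (narg k) -> ev w' (u y) (g k)) ->
  ev w (pE2 u) (E2 g).
Proof. by move=> H0 H; apply: ev_call H0 _; exists g. Qed.

(** The two truncated differences sum to 0 exactly when [m * d = n], so [E2] searches for a
    quotient. *)
Definition pdvd (d n : prog) : prog :=
  psub (pconst 1) (pE2 (fun m => padd (psub (pmul (pvar m) d) n)
                                      (psub n (pmul (pvar m) d)))).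

Lemma ev_dvd w t u d n : has_E2 w -> ev w t d -> ev w u n ->
  ev w (pdvd t u) (d %| n).
Proof.
move=> w0 Ht Hu.
have -> : (d %| n : nat) = 1 - E2 (fun m => (m * d - n) + (n - m * d)).
  rewrite /E2; case: asboolP => [[m /eqP]|H].
    rewrite addn_eq0 !subn_eq0 -eqn_leq => /eqP <-.
    by rewrite dvdn_mull.
  by case: dvdnP => // -[m mE]; case: H; exists m; rewrite -mE !subnn.
apply: ev_sub; first exact: ev_const.
apply: ev_E2 => // k y w' e Hy.
have vy := ev_var Hy; have {}Ht := ev_ext e Ht; have {}Hu := ev_ext e Hu.
by apply: ev_add; apply: ev_sub => //; exact: ev_mul.
Qed.

(** Bounding the exponents by [n] itself turns the valuation into a primitive recursion; the top
    term vanishes because p ^ n > n. *)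
Lemma logn_sum p n : prime p -> logn p n = \sum_(0 <= i < n) (p ^ i.+1 %| n).
Proof.
move=> pp; case: n => [|n]; first by rewrite logn0 big_geq.
rewrite logn_count_dvd // big_add1 /= big_nat_recr //=.
have -> : (p ^ n.+1 %| n.+1) = false by rewrite gtnNdvd // ltn_expl // prime_gt1.
by rewrite addn0.
Qed.

Definition plogn (p : nat) (n : prog) : prog :=
  prec n (pconst 0)
    (fun i m => padd (pvar m) (pdvd (pexp (pconst p) (psucc (pvar i))) n)).

Lemma ev_logn w p t n : prime p -> has_E2 w -> ev w t n ->
  ev w (plogn p t) (logn p n).
Proof.
move=> pp w0 Ht; rewrite logn_sum //.
apply: (ev_rec (f := fun k => \sum_(0 <= i < k) (p ^ i.+1 %| n))) => //.
  by rewrite big_geq //; exact: ev_const.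
move=> i x y w' e Hx Hy; rewrite big_nat_recr //=.
apply: ev_add; first exact: ev_var.
apply: ev_dvd; [exact: e | | exact: ev_ext Ht].
by apply: ev_exp; [exact: ev_const | apply: ev_succ; exact: ev_var].
Qed.

(* For u = (A - B) / (C + 1) and v = (A' - B') / (C' + 1), clearing
   denominators in u + 2 / 2 ^ k < v gives code_lhs u v k < code_rhs u v k. *)
Definition code_lhs u v k : nat :=
  2 ^ k * (logn 2 u * (logn 5 v).+1 + logn 3 v * (logn 5 u).+1) +
  2 * ((logn 5 u).+1 * (logn 5 v).+1).

Definition code_rhs u v k : nat :=
  2 ^ k * (logn 2 v * (logn 5 u).+1 + logn 3 u * (logn 5 v).+1).

Definition plhs (u v k : prog) : prog :=
  padd (pmul (pexp (pconst 2) k)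
    (padd (pmul (plogn 2 u) (psucc (plogn 5 v)))
          (pmul (plogn 3 v) (psucc (plogn 5 u)))))
    (pmul (pconst 2) (pmul (psucc (plogn 5 u)) (psucc (plogn 5 v)))).

Definition prhs (u v k : prog) : prog :=
  pmul (pexp (pconst 2) k)
    (padd (pmul (plogn 2 v) (psucc (plogn 5 u)))
          (pmul (plogn 3 u) (psucc (plogn 5 v)))).

Ltac ev_step := match goal with
  | |- ev _ (padd _ _) _ => apply: ev_add
  | |- ev _ (pmul _ _) _ => apply: ev_mul
  | |- ev _ (psub _ _) _ => apply: ev_sub
  | |- ev _ (pexp _ _) _ => apply: ev_exp
  | |- ev _ (psucc _) _ => apply: ev_succ
  | |- ev _ (pconst _) _ => exact: ev_const
  | |- ev _ (plogn _ _) _ => apply: ev_logn => //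
  | |- ev _ (plhs _ _ _) _ => rewrite /plhs /code_lhs
  | |- ev _ (prhs _ _ _) _ => rewrite /prhs /code_rhs
  | |- _ => assumption
  end.

Lemma ev_lhs w t u s m n k : has_E2 w -> ev w t m -> ev w u n -> ev w s k ->
  ev w (plhs t u s) (code_lhs m n k).
Proof.
by move=> w0 Ht Hu Hs; repeat ev_step.
Qed.

Lemma ev_rhs w t u s m n k : has_E2 w -> ev w t m -> ev w u n -> ev w s k ->
  ev w (prhs t u s) (code_rhs m n k).
Proof.
by move=> w0 Ht Hu Hs; repeat ev_step.
Qed.

(** The difference is 0 exactly when [code_lhs < code_rhs]: [E2] searches for a witness that a is
    below b, giving 0 if there is one and 1 otherwise. *)
Definition real_ge (a b : nat -> nat) : nat :=
  E2 (fun k => (code_lhs (a k) (b k) k).+1 - code_rhs (a k) (b k) k).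

Definition pge (u v : nat -> prog) : prog :=
  pE2 (fun k => psub (psucc (plhs (u k) (v k) (pvar k)))
                     (prhs (u k) (v k) (pvar k))).

Lemma ev_ge w u v a b : has_E2 w ->
  evl w (u : binder ty1) (a : tot ty1) -> evl w (v : binder ty1) (b : tot ty1) ->
  ev w (pge u v) (real_ge a b).
Proof.
move=> w0 Hu Hv; apply: ev_E2 => // k y w' e Hy.
have vy := ev_var Hy; have {}Hu := Hu k y w' e Hy; have {}Hv := Hv k y w' e Hy.
by apply: ev_sub; [apply: ev_succ; apply: ev_lhs | apply: ev_rhs] => //; exact: e.
Qed.

(** * Comparison of coded reals *)

Import Order.TTheory GRing.Theory Num.Theory.
Import numFieldNormedType.Exports.
Local Open Scope classical_set_scope.
Local Open Scope ring_scope.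

Lemma code_ltE u v k : (code_lhs u v k < code_rhs u v k)%N =
  (rat_of_code u + 2 / 2 ^+ k < rat_of_code v).
Proof.
rewrite /code_lhs /code_rhs /rat_of_code.
move: (logn 2 u) (logn 3 u) (logn 5 u) => A B C.
move: (logn 2 v) (logn 3 v) (logn 5 v) => A' B' C'.
rewrite -(ltr_nat rat) !(natrD, natrM, natrX).
have := ltr0Sn rat C; have := ltr0Sn rat C'.
move: (C.+1%:R : rat) (C'.+1%:R : rat) => c c' c'0 c0.
have : 0 < 2 ^+ k :> rat by rewrite exprn_gt0.
move: (2 ^+ k : rat) => K k0.
rewrite -[RHS](ltr_pM2r (mulr_gt0 (mulr_gt0 c0 c'0) k0)).
(* Subtracting the terms in B and B' restores the signed numerators, which had been moved across to
   stay within the natural numbers. *)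
rewrite -[LHS](ltrD2r (- (K * (B'%:R * c + B%:R * c')))).
by congr (_ < _); field; rewrite ?gt_eqF.
Qed.

Section RealCodes.
Variable R : realType.
Implicit Types (x y : R) (a b : nat -> nat).

Lemma ratr_pow2 n : ratr (2 ^- n : rat) = 2 ^- n :> R.
Proof. by rewrite fmorphV rmorphXn /= ratr_nat. Qed.

Lemma ratr_add_pow2 q n : ratr (q + 2 / 2 ^+ n) = ratr q + 2 * 2 ^- n :> R.
Proof. by rewrite rmorphD /= rmorphM /= ratr_pow2 ratr_nat. Qed.

(** Let k tend to infinity in the inequality of [fast_cauchy]. *)
Lemma codes_real_dist a x n :
  codes_real a x -> `|ratr (rat_of_code (a n)) - x| <= 2 ^- n.
Proof.
move=> [fa ca].
have cd : (fun k => `|ratr (rat_of_code (a n)) -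
    ratr (rat_of_code (a (n + k)%N))| : R) @ \oo -->
    `|ratr (rat_of_code (a n)) - x|.
  apply: cvg_norm; apply: cvgB; first exact: cvg_cst.
  have := ca; rewrite -(cvg_shiftn n); apply: cvg_trans; apply: near_eq_cvg.
  by apply: nearW => k /=; rewrite addnC.
rewrite -(cvg_lim _ cd) //; apply: limr_le.
  by apply/cvg_ex; exists (`|ratr (rat_of_code (a n)) - x|).
apply: nearW => k; rewrite -rmorphB -[leRHS]ratr_pow2.
by rewrite -ratr_norm ler_rat ltW.
Qed.

(** A gap above 2 * 2 ^- k outweighs the two approximation errors. Conversely the errors and the gap
    cost 4 * 2 ^- N in all, so any N with 2 ^- N < (y - x) / 4 is a witness. *)
Lemma codes_real_lt a b x y : codes_real a x -> codes_real b y ->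
  (exists k, (code_lhs (a k) (b k) k < code_rhs (a k) (b k) k)%N) <-> x < y.
Proof.
move=> ax yb; split=> [[k]|xy].
  rewrite code_ltE -(ltr_rat R) ratr_add_pow2 => H.
  have := codes_real_dist k ax; have := codes_real_dist k yb.
  rewrite !ler_norml => /andP[_ ?] /andP[? _]; lra.
have : (fun n => 2^-1 ^+ n : R) @ \oo --> 0.
  by apply: cvg_expr; rewrite ger0_norm ?invr_ge0 // invf_lt1 // ltr1n.
have e0 : 0 < (y - x) / 4 by rewrite divr_gt0 ?subr_gt0.
move=> /cvgr0_norm_lt/(_ _ e0)[N _ /(_ N (leqnn N))] /=.
rewrite ger0_norm ?exprn_ge0 ?invr_ge0 // exprVn => HN.
exists N; rewrite code_ltE -(ltr_rat R) ratr_add_pow2.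
have := codes_real_dist N ax; have := codes_real_dist N yb.
rewrite !ler_norml => /andP[? _] /andP[_ ?]; lra.
Qed.

Lemma real_geE a b x y : codes_real a x -> codes_real b y ->
  real_ge a b = (y <= x)%R.
Proof.
move=> ax yb; rewrite /real_ge /E2 leNgt.
have H := codes_real_lt ax yb.
case: asboolP => [[k /eqP E]|N].
  by rewrite (H.1 _) //; exists k; rewrite -subn_eq0 E.
case: ltP => // /H.2[k Hk]; case: N; exists k; apply/eqP.
by rewrite subn_eq0.
Qed.

Lemma codes_real_cst c : codes_real (fun=> c) (ratr (rat_of_code c) : R).
Proof.
split; last exact: cvg_cst.
by move=> n k; rewrite subrr normr0 invr_gt0 exprn_gt0.
Qed.

Lemma rat_of_code_frac m d : (0 < d)%N ->
  rat_of_code (2 ^ m * 5 ^ d.-1) = m%:R / d%:R.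
Proof.
move=> d0; rewrite /rat_of_code !lognM ?expn_gt0 // !lognX.
rewrite !(@logn_prime _ _) //= !muln0 !muln1 !addn0 add0n subr0.
by rewrite prednK.
Qed.

Lemma codes_real0 : codes_real (fun=> 1%N) (0 : R).
Proof.
have -> : 0 = ratr (rat_of_code 1) :> R; last exact: codes_real_cst.
by rewrite (@rat_of_code_frac 0 1) // mul0r rmorph0.
Qed.

Lemma codes_real1 : codes_real (fun=> 2%N) (1 : R).
Proof.
have -> : 1 = ratr (rat_of_code 2) :> R; last exact: codes_real_cst.
by rewrite (@rat_of_code_frac 1 1) // divr1 rmorph1.
Qed.

Lemma codes_real_bool (P : bool) :
  codes_real (fun=> (2 * P)%N) (P%:R : R).
Proof.
case: P; first exact: codes_real1.
(* The code 0 also denotes the rational 0, since [logn] is 0 at 0 by convention. *)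
have -> : false%:R = ratr (rat_of_code 0) :> R; last exact: codes_real_cst.
by rewrite /rat_of_code !logn0 subrr mul0r [RHS]rmorph0.
Qed.

End RealCodes.

(** * Closed sets and upper semicontinuous functions *)

Section ClosedAndUsco.
Variable R : realType.
Implicit Types (x y : R) (C : set R) (f : R -> R).

Lemma I01E x : I01 x = (0 <= x <= 1) :> Prop.
Proof. by rewrite /I01 /= in_itv. Qed.

Lemma closed_I01 : closed (@I01 R).
Proof. exact: interval_closed. Qed.

(** Choose a point in each set; by compactness the sequence clusters at some p, and each closed
    [C n] contains a tail of it, hence p. *)
Lemma nested_closed_bigcap (C : nat -> set R) :
  (forall n, [/\ closed (C n), C n !=set0, C n.+1 `<=` C n & C n `<=` @I01 R]) ->
  \bigcap_n C n !=set0.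
Proof.
move=> HC; have C_sub m n : (m <= n)%N -> C n `<=` C m.
  elim: n => [|n IH]; first by rewrite leqn0 => /eqP ->.
  rewrite leq_eqVlt => /orP[/eqP -> //|/IH Cn].
  by apply: subset_trans Cn; case: (HC n).
have [u Cu] := choice (fun n => let: And4 _ n0 _ _ := HC n in n0).
have [|p [_ pu]] := @segment_compact R 0 1 (u @ \oo).
  by exists 0%N => // n _; have [_ _ _] := HC n; apply; exact: Cu.
exists p => n _; have [Cn _ _ _] := HC n; apply: Cn => V /(pu (C n) V).
by apply; exists n => // m /C_sub; apply; exact: Cu.
Qed.

(** The limsup is an infimum of suprema over punctured relative neighbourhoods, so one of these
    suprema is already below y; the point x itself is covered by hypothesis. *)
Lemma usco01_near f x y : usco01 f -> I01 x -> f x < y ->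
  \forall z \near x, I01 z -> f z < y.
Proof.
move=> uf Ix fxy; have := le_lt_trans (uf _ Ix) (_ : (f x)%:E < y%:E)%E.
rewrite lte_fin => /(_ fxy); rewrite /limf_esup => /ereal_inf_lt[_ [V FV <-]] sV.
have : \forall z \near x, z != x -> I01 z -> V z by exact: FV.
apply: filterS => z Vz Iz; have [->//|/Vz/(_ Iz) {}Vz] := eqVneq z x.
rewrite -lte_fin; apply: le_lt_trans sV.
by apply: ereal_sup_ubound; exists z.
Qed.

Lemma usco01_superlevel_closed f y : usco01 f ->
  closed [set x | I01 x /\ y <= f x].
Proof.
move=> uf x xcl; have Ix : I01 x.
  apply: closed_I01; apply: closure_subset xcl => z; by case.
split=> //; rewrite leNgt; apply/negP => /(usco01_near uf Ix)/xcl[z [[Iz yz] /(_ Iz)]].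
by rewrite ltNge yz.
Qed.

Lemma usco01_attains_sup f : usco01 f ->
  exists x, [/\ I01 x, f x = sup (f @` @I01 R) &
    forall z, I01 z -> f z <= sup (f @` @I01 R)].
Proof.
move=> uf; have I0 : @I01 R 0 by rewrite I01E lexx ler01.
(* Superlevel sets at nondecreasing levels, each reached by f, are nested, closed and non-empty. *)
have nest (y : nat -> R) : (forall n, y n <= y n.+1) ->
    (forall n, exists2 x, I01 x & y n <= f x) ->
    exists2 x, I01 x & forall n, y n <= f x.
  move=> ymono yf.
  have [|x Hx] := @nested_closed_bigcap (fun n => [set x | I01 x /\ y n <= f x]).
    move=> n; split; first exact: usco01_superlevel_closed.
    - by have [x Ix yx] := yf n; exists x.
    - by move=> x /= [Ix yx]; split=> //; exact: le_trans (ymono n) yx.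
    - by move=> x [].
  by exists x => [|n]; [case: (Hx 0%N) | case: (Hx n)].
(* If f were unbounded, every level n would be reached, and a common point would have a value above
   all natural numbers. *)
have hs : has_sup (f @` @I01 R).
  split; first by exists (f 0), 0.
  apply: contrapT => nub.
  have [|n|x _ Hx] := nest (fun n => n%:R).
  - by move=> n; rewrite ler_nat.
  - apply: contrapT => H; apply: nub; exists n%:R => _ [x Ix <-].
    by rewrite leNgt; apply/negP => /ltW nf; apply: H; exists x.
  - have := Hx (Num.bound `|f x|); rewrite leNgt => /negP; apply.
    by apply: le_lt_trans (ler_norm _) _; exact: archi_boundP.
(* A common point of the levels sup - 1 / (n + 1) attains the supremum. *)
have [n|n|x Ix Hx] := nest (fun n => sup (f @` @I01 R) - n.+1%:R^-1).
- by rewrite lerD2l lerN2 lef_pV2 ?posrE ?ltr0n // ler_nat.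
- have [|_ [x Ix <-] /ltW Hx] := @sup_adherent _ (f @` @I01 R) n.+1%:R^-1 _ hs.
    by rewrite invr_gt0 ltr0n.
  by exists x.
have ub z : I01 z -> f z <= sup (f @` @I01 R).
  by move=> Iz; apply: ub_le_sup; [case: hs | exists z].
exists x; split=> //; apply/eqP; rewrite eq_le ub //=.
rewrite leNgt; apply/negP => /ltr_add_invr[n].
by rewrite -ltrBrDr ltNge Hx.
Qed.

(** The limsup is bounded by the supremum over any one neighbourhood: the whole line at points of C,
    and elsewhere the open complement of C, where the indicator is 0. *)
Lemma usco01_indic C : closed C -> usco01 (\1_C : R -> R).
Proof.
move=> cC x0 _; rewrite /limf_esup.
have [Cx|nCx] := pselect (C x0).
  apply: (@le_trans _ _ (ereal_sup ((EFin \o \1_C) @` setT))).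
    by apply: ereal_inf_lbound; exists setT => //; exact: filterT.
  apply: ge_ereal_sup => _ [z _ <-] /=.
  by rewrite lee_fin !indicE (mem_set Cx); case: (_ \in _).
apply: (@le_trans _ _ (ereal_sup ((EFin \o \1_C) @` (~` C)))).
  apply: ereal_inf_lbound; exists (~` C) => //.
  have : nbhs x0 (~` C) by apply: open_nbhs_nbhs; split => //; exact: closed_openC.
  by rewrite /within /dnbhs /=; apply: filterS => z nCz _ _.
apply: ge_ereal_sup => _ [z nCz <-] /=.
by rewrite lee_fin !indicE (memNset nCx) (memNset nCz).
Qed.

Lemma sup_indic01 C : C `<=` @I01 R -> C !=set0 ->
  sup ((\1_C : R -> R) @` @I01 R) = 1.
Proof.
move=> CI [c Cc]; apply/eqP; rewrite eq_le; apply/andP; split.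
  apply: ge_sup; first by exists (\1_C c), c => //; exact: CI.
  by move=> _ [z _ <-]; rewrite indicE; case: (_ \in _).
apply: ub_le_sup.
  by exists 1 => _ [z _ <-]; rewrite indicE; case: (_ \in _).
by exists c; [exact: CI | rewrite indicE (mem_set Cc)].
Qed.

End ClosedAndUsco.

(** * A real in [0, 1] avoiding a given sequence *)

Section Diagonal.
Variable R : realType.
Implicit Types (u : nat -> R).

(* diag_num u n / 4 ^ n is a partial sum; each base-4 digit, 0 or 1, of the limit
   is chosen to make it differ from u n. *)
Fixpoint diag_num u n : nat :=
  if n is n.+1 then
    let m := (4 * diag_num u n)%N in (m + (u n < m.+1%:R / 4 ^+ n.+1)%R)%N
  else 0%N.

Definition diag_code u n : nat := (2 ^ diag_num u n * 5 ^ (4 ^ n).-1)%N.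

Definition diag_frac u n : R := ratr (rat_of_code (diag_code u n)).

Definition diag u : R := limn (diag_frac u).

Lemma rat_of_diag_code u n :
  rat_of_code (diag_code u n) = (diag_num u n)%:R / 4 ^+ n.
Proof. by rewrite rat_of_code_frac ?expn_gt0 // natrX. Qed.

Lemma rat_of_diag_codeS u n : rat_of_code (diag_code u n.+1) =
  rat_of_code (diag_code u n) +
    (u n < (4 * diag_num u n)%N.+1%:R / 4 ^+ n.+1)%R%:R / 4 ^+ n.+1.
Proof.
rewrite !rat_of_diag_code /=; move: (u n < _)%R => b; rewrite natrD natrM exprS.
by field; rewrite expf_neq0.
Qed.

(** The upper bound is the geometric sum of 4 ^- i over n < i <= n + k, in closed form. *)
Lemma rat_of_diag_code_addn u n k :
  0 <= rat_of_code (diag_code u (n + k)) - rat_of_code (diag_code u n) <=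
    3^-1 / 4 ^+ n - 3^-1 / 4 ^+ (n + k).
Proof.
elim: k => [|k IH]; first by rewrite addn0 !subrr lexx.
rewrite addnS rat_of_diag_codeS; move: (u _ < _)%R => b; rewrite exprS.
have : 0 < (4 ^+ (n + k))^-1 :> rat by rewrite invr_gt0 exprn_gt0.
rewrite invfM; move: (4 ^+ (n + k))^-1 (4 ^+ n)^-1 IH => p q.
by case: b => /andP[] /= ? ? ?; apply/andP; split; lra.
Qed.

Lemma diag_code_fast u : fast_cauchy (diag_code u).
Proof.
move=> n k; have /andP[H0 H1] := rat_of_diag_code_addn u n k.
rewrite distrC ger0_norm //; apply: le_lt_trans H1 _.
have : 0 < (4 ^+ (n + k))^-1 :> rat by rewrite invr_gt0 exprn_gt0.
have : 0 < (2 ^+ n)^-1 :> rat by rewrite invr_gt0 exprn_gt0.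
have : (4 ^+ n)^-1 <= (2 ^+ n)^-1 :> rat.
  by rewrite lef_pV2 ?posrE ?exprn_gt0 // lerXn2r ?nnegrE.
by move: (4 ^+ (n + k))^-1 (4 ^+ n)^-1 (2 ^+ n)^-1 => p q r; lra.
Qed.

Lemma diag_frac_addn u n k :
  diag_frac u n <= diag_frac u (n + k) <= diag_frac u n + 3^-1 / 4 ^+ n.
Proof.
have /andP[H0 H1] := rat_of_diag_code_addn u n k.
rewrite /diag_frac ler_rat -subr_ge0 H0 /=.
have -> : 3^-1 / 4 ^+ n = ratr (3^-1 / 4 ^+ n) :> R.
  by rewrite rmorphM /= !fmorphV rmorphXn /= !ratr_nat.
rewrite -rmorphD /= ler_rat -lerBlDl; apply: le_trans H1 _.
by rewrite gerBl mulr_ge0 // invr_ge0 // exprn_ge0.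
Qed.

Lemma is_cvg_diag_frac u : cvgn (diag_frac u).
Proof.
apply: nondecreasing_is_cvgn.
  apply/nondecreasing_seqP => n.
  by have := diag_frac_addn u n 1; rewrite addn1 => /andP[].
exists (diag_frac u 0 + 3^-1 / 4 ^+ 0) => _ [n _ <-].
by have /andP[_] := diag_frac_addn u 0 n.
Qed.

Lemma diag_bounds u n :
  diag_frac u n <= diag u <= diag_frac u n + 3^-1 / 4 ^+ n.
Proof.
apply/andP; split.
  apply: limr_ge; first exact: is_cvg_diag_frac.
  exists n => // m /= nm.
  by have := diag_frac_addn u n (m - n); rewrite subnKC // => /andP[].
apply: limr_le; first exact: is_cvg_diag_frac.
exists n => // m /= nm.
by have := diag_frac_addn u n (m - n); rewrite subnKC // => /andP[].
Qed.

Lemma codes_diag u : codes_real (diag_code u) (diag u).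
Proof. by split; [exact: diag_code_fast | exact: is_cvg_diag_frac]. Qed.

Lemma diag_I01 u : I01 (diag u).
Proof.
rewrite I01E; have := diag_bounds u 0; rewrite /diag_frac rat_of_diag_code /=.
rewrite mul0r rmorph0 expr0 divr1 add0r => /andP[-> H]; apply: le_trans H _.
by rewrite invf_le1 // ler1n.
Qed.

(** With m = 4 * [diag_num u n], the threshold is (m + 1) / 4 ^ (n + 1). If [u n] is below it, the
    digit 1 puts the limit at or above it; otherwise the digit 0 keeps the limit at most (m + 1/3) /
    4 ^ (n + 1), strictly below it. *)
Lemma diag_neq u n : diag u != u n.
Proof.
have := diag_bounds u n.+1.
have -> : diag_frac u n.+1 = (4 * diag_num u n)%N%:R / 4 ^+ n.+1 +
    (u n < (4 * diag_num u n)%N.+1%:R / 4 ^+ n.+1)%R%:R / 4 ^+ n.+1.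
  rewrite /diag_frac rat_of_diag_code rmorphM fmorphV /= rmorphXn /=.
  by rewrite !ratr_nat natrD mulrDl.
rewrite -[(4 * _).+1%:R]natr1 mulrDl mul1r.
have : 0 < (4 ^+ n.+1)^-1 :> R by rewrite invr_gt0 exprn_gt0.
move: (4 ^+ n.+1)^-1 ((4 * diag_num u n)%N%:R) => p q p0.
case: ltP => /= H /andP[? ?].
  by rewrite gt_eqF //; lra.
by rewrite lt_eqF //; lra.
Qed.

End Diagonal.

(** * The reductions *)

Definition papp1 (a k : nat) : prog := @pcall ty1 a (pvar k, tt).

Lemma ev_app1 w a k (v : tot ty1) n : look w a = Some (targ v) ->
  look w k = Some (narg n) -> ev w (papp1 a k) (v n).
Proof.
by move=> Ha Hk; apply: ev_call Ha _; exists n; split => //; exact: ev_var.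
Qed.

Lemma evl_var1 w a (v : tot ty1) : look w a = Some (targ v) ->
  evl w (papp1 a : binder ty1) v.
Proof. by move=> Ha n y w' e Hy; apply: ev_app1 Hy; exact: e. Qed.

Definition papp2 (c a : nat) : prog := @pcall ty2 c (papp1 a : binder ty1, tt).

Lemma ev_app2 w c a (F : tot ty2) (v : tot ty1) : look w c = Some (targ F) ->
  look w a = Some (targ v) -> ev w (papp2 c a) (F v).
Proof.
by move=> Hc Ha; apply: ev_call Hc _; exists v; split => //; exact: evl_var1.
Qed.

Lemma evl_const1 w q : evl w ((fun=> pconst q) : binder ty1) (fun=> q).
Proof. by move=> n y w' _ _; exact: ev_const. Qed.

(* Argument lists number their entries from the end, as [fresh] does. *)
Fixpoint world_of (a : seq arg) : world :=
  if a is v :: a' then (size a', v) :: world_of a' else [::].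

(** The list of names depends only on the number of arguments, so one index serves all inputs. *)
Lemma kleene_ev (t : prog) a n : ev (world_of a) t n ->
  kleene (t (rev (iota 0 (size a)))) a n.
Proof.
have wfa : wf (world_of a) /\ size (world_of a) = size a.
  elim: a => //= v a [IH sa]; split; last by rewrite sa.
  rewrite -sa; exact: wf_fresh.
have -> : rev (iota 0 (size a)) = unzip1 (world_of a).
  elim: a {wfa} => // v a IH.
  by rewrite [size (v :: a)]/= -[(size a).+1]addn1 iotaD rev_cat /= add0n IH.
have E : unzip2 (world_of a) = a by elim: a {wfa} => //= v a ->.
by move=> H; rewrite -[X in kleene _ X]E; apply: H (@ext_refl _); case: wfa.
Qed.

(* The constant sequences 1 and 2 code the reals 0 and 1. *)
Definition superlevel_set (p : tot (ty1 :-> ty1)) (b : tot ty1) : tot ty2 :=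
  fun a => (real_ge a (fun=> 1) * (real_ge (fun=> 2) a * real_ge (p a) b))%N.

Definition psuperlevel_set (p b a : nat) : prog :=
  pmul (pge (papp1 a) (fun=> pconst 1))
    (pmul (pge (fun=> pconst 2) (papp1 a))
      (pge (fun k => @pcall (ty1 :-> ty1) p (papp1 a : binder ty1, (pvar k, tt)))
           (papp1 b))).

Lemma ev_superlevel_set w p b a (vp : tot (ty1 :-> ty1)) (vb va : tot ty1) :
  has_E2 w ->
  look w p = Some (targ vp) -> look w b = Some (targ vb) ->
  look w a = Some (targ va) ->
  ev w (psuperlevel_set p b a) (superlevel_set vp vb va).
Proof.
move=> w0 Hp Hb Ha; have la := evl_var1 Ha; have lb := evl_var1 Hb.
apply: ev_mul; first by apply: ev_ge => //; exact: evl_const1.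
apply: ev_mul; first by apply: ev_ge => //; exact: evl_const1.
apply: ev_ge => // k y w' e Hy.
apply: (@ev_call _ (ty1 :-> ty1)%ty p (par_of_tot vp)); first exact: e Hp.
exists va; split; first by apply: evl_var1; exact: e Ha.
by exists k; split; [exact: ev_var | ].
Qed.

(** [E2] returns 0 exactly when some [c n a] is 0, that is, when the point is outside some set of
    the sequence. *)
Definition inter_set (c : tot (ty0 :-> ty2)) : tot ty2 :=
  fun a => E2 (fun n => c n a).

Definition pinter_set (c a : nat) : prog :=
  pE2 (fun n => @pcall (ty0 :-> ty2) c (pvar n, (papp1 a : binder ty1, tt))).

Lemma ev_inter_set w c a (vc : tot (ty0 :-> ty2)) (va : tot ty1) : has_E2 w ->
  look w c = Some (targ vc) -> look w a = Some (targ va) ->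
  ev w (pinter_set c a) (inter_set vc va).
Proof.
move=> w0 Hc Ha; apply: (ev_E2 (g := fun n => vc n va)) => // k y w' e Hy.
apply: (@ev_call _ (ty0 :-> ty2)%ty c (par_of_tot vc)); first exact: e Hc.
exists k; split; first exact: ev_var.
by exists va; split => //; apply: evl_var1; exact: e Ha.
Qed.

(** The second factor is the truncated 1 - |p a - k|, the indicator of [p a = k]. *)
Definition fibre_set (c p : tot ty2) (k : nat) : tot ty2 :=
  fun a => (c a * (1 - (p a - k + (k - p a))))%N.

Definition pfibre_set (c p k a : nat) : prog :=
  pmul (papp2 c a) (psub (pconst 1)
    (padd (psub (papp2 p a) (pvar k)) (psub (pvar k) (papp2 p a)))).

Lemma ev_fibre_set w c p k a (vc vp : tot ty2) n (va : tot ty1) :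
  look w c = Some (targ vc) -> look w p = Some (targ vp) ->
  look w k = Some (narg n) -> look w a = Some (targ va) ->
  ev w (pfibre_set c p k a) (fibre_set vc vp n va).
Proof.
move=> Hc Hp /ev_var Hk Ha; have {}Hc := ev_app2 Hc Ha; have {}Hp := ev_app2 Hp Ha.
by rewrite /pfibre_set /fibre_set; repeat ev_step.
Qed.

Section Semantics.
Variable R : realType.
Implicit Types (x y : R) (f : R -> R) (C : set R).

Lemma codes_superlevel_set f y p b : codes_fun01 p f -> codes_real b y ->
  codes_set (superlevel_set p b) [set x | I01 x /\ y <= f x].
Proof.
move=> pf yb a x ax; rewrite /superlevel_set.
rewrite (real_geE ax (@codes_real0 R)) (real_geE (@codes_real1 R) ax).
(* Outside [0, 1] nothing is known about [p a], but one of the first two factors is 0. *)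
have [Ix|nIx] := pselect (I01 x); last first.
  case: asboolP => [[]//|_]; move: nIx; rewrite I01E.
  by case: (0 <= x); case: (x <= 1).
rewrite (real_geE (pf _ _ Ix ax) yb).
have := Ix; rewrite I01E => /andP[-> ->]; rewrite !mul1n.
case: asboolP => [[_ ->]//|H].
by case: (boolP (y <= f x)) => // yf; case: H.
Qed.

Lemma codes_inter_set (C : nat -> set R) c : (forall n, codes_set (c n) (C n)) ->
  codes_set (inter_set c) (\bigcap_n C n).
Proof.
move=> cC a x ax; rewrite /inter_set /E2.
case: asboolP => [[n]|none]; case: asboolP => //.
  by move=> H; rewrite (cC n _ _ ax); case: asboolP => // -[]; exact: H.
move=> [] n _; apply: contrapT => nC; case: none; exists n.
by rewrite (cC n _ _ ax); case: asboolP.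
Qed.

Lemma codes_fibre_set C (Y : R -> nat) c p k : codes_set c C -> codes_fun_nat p Y ->
  codes_set (fibre_set c p k) [set x | C x /\ Y x = k].
Proof.
move=> cC pY a x ax; rewrite /fibre_set (cC _ _ ax) (pY _ _ ax).
have -> : (1 - (Y x - k + (k - Y x)) = (Y x == k))%N.
  by rewrite eqn_leq -!subn_eq0 -addn_eq0; case: (_ + _)%N.
case: asboolP => Cx; case: asboolP => [[_ ->]|H] //; rewrite ?eqxx // mul1n.
by case: eqP => // E; case: H.
Qed.

(** The constant sequence [2 * c a] is 2 or 0, and these code the rationals 1 and 0. *)
Lemma codes_indic C c : codes_set c C ->
  codes_fun01 (fun a _ => 2 * c a)%N (\1_C : R -> R).
Proof.
move=> cC a x _ ax; rewrite (cC _ _ ax) indicE.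
case: asboolP => Cx; first by rewrite (mem_set Cx); exact: (codes_real_bool R true).
by rewrite (memNset Cx); exact: (codes_real_bool R false).
Qed.

(** * Computations between the three specifications *)

Lemma closed_selection_usco :
  computes_assuming_E2 (@closed_selection R) (@usco_maximiser R).
Proof.
apply: computes_assuming_E2_intro => F [w Fw].
(* Names count from the end of the argument list: 0 is [E2], 1 the given functional, 2 and 3 the
   inputs [p] and [b], and 4 the position in the output sequence. *)
pose t : prog := @pcall (ty2 :-> ty1) 1 (psuperlevel_set 2 3, (pvar 4, tt)).
exists (t (rev (iota 0 5))) => G HG.
exists (fun f y => w [set x | I01 x /\ y <= f x]) => f y p b uf ysup pf yb.
have [x [Ix fx fub]] := usco01_attains_sup uf.
have ne : [set x | I01 x /\ y <= f x] !=set0.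
  by exists x; split=> //; rewrite fx ysup.
have [[Iw yw] [a [wa Fa]]] := Fw _ _ (usco01_superlevel_closed uf)
  (fun _ => @proj1 _ _) ne (codes_superlevel_set pf yb).
(* Membership in the superlevel set gives y <= f, and y being the supremum gives the converse. *)
split=> //; first by apply: le_anti; rewrite yw andbT [leRHS]ysup fub.
exists a; split=> // n; apply/HG.
apply: (kleene_ev (a := [:: narg n; targ b; targ p; parg F; targ E2])).
apply: (@ev_call _ (ty2 :-> ty1)%ty 1 F) => //.
exists (superlevel_set p b); split.
  by move=> v k w' e Hk; apply: ev_superlevel_set => //; exact: e.
by exists n; split; [exact: ev_var | exact: Fa].
Qed.

Lemma usco_closed_selection :
  computes_assuming_E2 (@usco_maximiser R) (@closed_selection R).
Proof.
apply: computes_assuming_E2_intro => F [w Fw].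
pose t : prog := @pcall ((ty1 :-> ty1) :-> ty1 :-> ty1) 1
  ((fun a _ => pmul (pconst 2) (papp2 2 a)), (fun=> pconst 2, (pvar 3, tt))).
exists (t (rev (iota 0 4))) => G HG.
exists (fun C => w \1_C 1) => C c clC CI C0 cC.
have [Iw Cw [a [wa Fa]]] := Fw _ _ _ _ (usco01_indic clC)
  (esym (sup_indic01 CI C0)) (codes_indic cC) (codes_real1 R).
(* The indicator takes the value 1 at the selected point, which therefore lies in C. *)
split.
  move: Cw; rewrite indicE; case: (boolP (_ \in _)) => [/set_mem //|_ /eqP].
  by rewrite eq_sym oner_eq0.
exists a; split=> // n; apply/HG.
apply: (kleene_ev (a := [:: narg n; targ c; parg F; targ E2])).
apply: (@ev_call _ ((ty1 :-> ty1) :-> ty1 :-> ty1)%ty 1 F) => //.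
exists (fun a _ => 2 * c a)%N; split.
  move=> v k w' e Hk u z w2 e2 _; apply: ev_mul; first exact: ev_const.
  by apply: ev_app2; apply: e2 => //; exact: e.
exists (fun=> 2%N); split; first exact: evl_const1.
by exists n; split; [exact: ev_var | exact: Fa].
Qed.

Lemma cantor_closed_selection :
  computes_assuming_E2 (@cantor_intersection R) (@closed_selection R).
Proof.
apply: computes_assuming_E2_intro => F [w Fw].
pose t : prog := @pcall ((ty0 :-> ty2) :-> ty1) 1 ((fun _ a => papp2 2 a), (pvar 3, tt)).
exists (t (rev (iota 0 4))) => G HG.
exists (fun C => w (fun=> C)) => C c clC CI C0 cC.
have [|Cw [a [wa Fa]]] := Fw (fun=> C) (fun=> c) _ (fun=> cC);
  first by move=> n; split.
split; first exact: (Cw 0%N).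
exists a; split=> // n; apply/HG.
apply: (kleene_ev (a := [:: narg n; targ c; parg F; targ E2])).
apply: (@ev_call _ ((ty0 :-> ty2) :-> ty1)%ty 1 F) => //.
exists (fun=> c); split.
  by move=> v k w' e _ u y w2 e2 Hy; apply: ev_app2 => //; apply: e2; exact: e.
by exists n; split; [exact: ev_var | exact: Fa].
Qed.

Lemma closed_selection_cantor :
  computes_assuming_E2 (@closed_selection R) (@cantor_intersection R).
Proof.
apply: computes_assuming_E2_intro => F [w Fw].
pose t : prog := @pcall (ty2 :-> ty1) 1 (pinter_set 2, (pvar 3, tt)).
exists (t (rev (iota 0 4))) => G HG.
exists (fun D : nat -> set R => w (\bigcap_n D n)) => C c HC cC.
have clC : closed (\bigcap_n C n) by apply: closed_bigI => n _; case: (HC n).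
have CI : \bigcap_n C n `<=` @I01 R.
  by move=> x /(_ 0%N I); have [_ _ _] := HC 0%N; apply.
have [Cw [a [wa Fa]]] :=
  Fw _ _ clC CI (nested_closed_bigcap HC) (codes_inter_set cC).
split=> //; exists a; split=> // n; apply/HG.
apply: (kleene_ev (a := [:: narg n; targ c; parg F; targ E2])).
apply: (@ev_call _ (ty2 :-> ty1)%ty 1 F) => //.
exists (inter_set c); split.
  by move=> v k w' e Hk; apply: ev_inter_set => //; exact: e.
by exists n; split; [exact: ev_var | exact: Fa].
Qed.

(** The intersection is inlined into the indicator, so that a single index does both steps and no
    closure of computability under composition has to be proved. *)
Lemma usco_cantor :
  computes_assuming_E2 (@usco_maximiser R) (@cantor_intersection R).
Proof.
apply: computes_assuming_E2_intro => F [w Fw].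
pose t : prog := @pcall ((ty1 :-> ty1) :-> ty1 :-> ty1) 1
  ((fun a _ => pmul (pconst 2) (pinter_set 2 a)), (fun=> pconst 2, (pvar 3, tt))).
exists (t (rev (iota 0 4))) => G HG.
exists (fun D : nat -> set R => w \1_(\bigcap_n D n) 1) => C c HC cC.
have clC : closed (\bigcap_n C n) by apply: closed_bigI => n _; case: (HC n).
have CI : \bigcap_n C n `<=` @I01 R.
  by move=> x /(_ 0%N I); have [_ _ _] := HC 0%N; apply.
have [Iw Cw [a [wa Fa]]] := Fw _ _ _ _ (usco01_indic clC)
  (esym (sup_indic01 CI (nested_closed_bigcap HC)))
  (codes_indic (codes_inter_set cC)) (codes_real1 R).
split.
  move: Cw; rewrite indicE; case: (boolP (_ \in _)) => [/set_mem //|_ /eqP].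
  by rewrite eq_sym oner_eq0.
exists a; split=> // n; apply/HG.
apply: (kleene_ev (a := [:: narg n; targ c; parg F; targ E2])).
apply: (@ev_call _ ((ty1 :-> ty1) :-> ty1 :-> ty1)%ty 1 F) => //.
exists (fun a _ => 2 * inter_set c a)%N; split.
  move=> v k w' e Hk u z w2 e2 _; apply: ev_mul; first exact: ev_const.
  by apply: ev_inter_set; apply: e2 => //; exact: e.
exists (fun=> 2%N); split; first exact: evl_const1.
by exists n; split; [exact: ev_var | exact: Fa].
Qed.

Lemma cantor_usco :
  computes_assuming_E2 (@cantor_intersection R) (@usco_maximiser R).
Proof.
apply: computes_assuming_E2_intro => F [w Fw].
pose t : prog := @pcall ((ty0 :-> ty2) :-> ty1) 1
  ((fun=> psuperlevel_set 2 3), (pvar 4, tt)).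
exists (t (rev (iota 0 5))) => G HG.
exists (fun f y => w (fun=> [set x | I01 x /\ y <= f x])) => f y p b uf ysup pf yb.
have [x [Ix fx fub]] := usco01_attains_sup uf.
have clS := usco01_superlevel_closed (y := y) uf.
have [|Cw [a [wa Fa]]] := Fw (fun=> [set x | I01 x /\ y <= f x]) _ _
  (fun=> codes_superlevel_set pf yb).
  split=> //; last by move=> z [].
  by exists x; split=> //; rewrite fx ysup.
have [Iw yw] := Cw 0%N I.
split=> //; first by apply: le_anti; rewrite yw andbT [leRHS]ysup fub.
exists a; split=> // n; apply/HG.
apply: (kleene_ev (a := [:: narg n; targ b; targ p; parg F; targ E2])).
apply: (@ev_call _ ((ty0 :-> ty2) :-> ty1)%ty 1 F) => //.
exists (fun=> superlevel_set p b); split.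
  move=> v k w' e _ u z w2 e2 Hz.
  by apply: ev_superlevel_set => //; apply: e2; exact: e.
by exists n; split; [exact: ev_var | exact: Fa].
Qed.


(** * The weak Cantor realiser by diagonalisation *)

Definition fibre_point (w : (nat -> set R) -> R) (A : set R) (Y : R -> nat) k :=
  w (fun=> [set x | A x /\ Y x = k]).

Definition pfibre_point (k j : nat) : prog :=
  @pcall ((ty0 :-> ty2) :-> ty1) 1
    ((fun _ a => pfibre_set 2 3 k a), (pvar j, tt)).

Definition pfrac (m d : prog) : prog :=
  pmul (pexp (pconst 2) m) (pexp (pconst 5) (psub d (pconst 1))).

Lemma ev_frac w m d vm vd : ev w m vm -> ev w d vd ->
  ev w (pfrac m d) (2 ^ vm * 5 ^ vd.-1)%N.
Proof. by move=> Hm Hd; rewrite -subn1 /pfrac; repeat ev_step. Qed.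

(** Subtracting the comparison from 1 turns >= into the strict test that decides the digit; the
    threshold enters as a constant sequence of codes. *)
Definition pdiag_num (n : prog) : prog :=
  prec n (pconst 0) (fun k m =>
    padd (pmul (pconst 4) (pvar m))
      (psub (pconst 1)
        (pge (pfibre_point k)
          (fun=> pfrac (psucc (pmul (pconst 4) (pvar m)))
                       (pexp (pconst 4) (psucc (pvar k))))))).

Lemma cantor_weak_cantor :
  computes_assuming_E2 (@cantor_intersection R) (@weak_cantor_realiser R).
Proof.
apply: computes_assuming_E2_intro => F [w Fw].
pose t : prog := pfrac (pdiag_num (pvar 4)) (pexp (pconst 4) (pvar 4)).
exists (t (rev (iota 0 5))) => G HG.
exists (fun A Y => diag (fibre_point w A Y)) => A Y c p AI Yinj Ysurj cA pY.
have fib k : (A (fibre_point w A Y k) /\ Y (fibre_point w A Y k) = k) /\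
    outputs (F (fun=> fibre_set c p k)) (fibre_point w A Y k).
  have [|H Ho] := Fw (fun=> [set x | A x /\ Y x = k]) (fun=> fibre_set c p k) _
    (fun=> codes_fibre_set k cA pY).
    have [z Az Yz] := Ysurj k.
    have -> : [set x | A x /\ Y x = k] = [set z].
      apply/seteqP; split=> [x [Ax Yx]|x ->] //=.
      by apply: Yinj; rewrite ?in_setE // Yx Yz.
    move=> n; split=> //.
    - by exists z.
    - by move=> _ ->; exact: AI.
  by split=> //; exact: (H 0%N).
have [v Fv] := choice (fun k => (fib k).2).
split; first exact: diag_I01.
  (* If d were in A, it would have the same [Y]-value as the fibre point at [Y d], hence equal it by
     injectivity, against [diag_neq]. *)
  move=> Ad; set d := diag _ in Ad *.
  have /eqP := diag_neq (fibre_point w A Y) (Y d); apply.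
  have [[Ad' Yd'] _] := fib (Y d).
  by apply: Yinj; rewrite ?in_setE.
exists (diag_code (fibre_point w A Y)); split=> [|n]; first exact: codes_diag.
apply/HG.
apply: (kleene_ev (a := [:: narg n; targ p; targ c; parg F; targ E2])).
set W := world_of _.
have evn : ev W (pvar 4) n by exact: ev_var.
apply: ev_frac; last by apply: ev_exp => //; exact: ev_const.
apply: ev_rec => //; first exact: ev_const.
move=> k x y W1 e Hx Hy /=.
apply: ev_add; first by apply: ev_mul; [exact: ev_const | exact: ev_var].
set r := _%R / _.
(* Here [v k] is the code of the fibre point that [F] returns; exactness of the comparison makes the
   digit the same for every such code. *)
have -> : (fibre_point w A Y k < r)%R =
    (1 - real_ge (v k) (fun=> 2 ^ (4 * diag_num (fibre_point w A Y) k).+1 *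
                              5 ^ (4 ^ k.+1).-1))%N :> nat.
  have [vk _] := Fv k.
  have rc := codes_real_cst R (2 ^ (4 * diag_num (fibre_point w A Y) k).+1 *
                              5 ^ (4 ^ k.+1).-1)%N.
  rewrite (real_geE vk rc) rat_of_code_frac ?expn_gt0 //.
  rewrite rmorphM fmorphV /= !ratr_nat natrX -/r ltNge.
  by case: (r <= _).
apply: ev_sub; first exact: ev_const.
apply: ev_ge; first exact: e.
  move=> j z W2 e2 Hz.
  apply: (@ev_call _ ((ty0 :-> ty2) :-> ty1)%ty 1 F); first by apply: e2; exact: e.
  exists (fun=> fibre_set c p k); split; last first.
    by exists j; split; [exact: ev_var | exact: (Fv k).2].
  move=> i u W3 e3 _ a b W4 e4 Hb.
  by apply: ev_fibre_set => //; apply: e4; apply: e3; apply: e2 => //; exact: e.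
move=> j z W2 e2 _; apply: ev_frac.
  apply: ev_succ; apply: ev_mul; first exact: ev_const.
  by apply: ev_var; exact: e2.
apply: ev_exp; first exact: ev_const.
by apply: ev_succ; apply: ev_var; exact: e2.
Qed.

End Semantics.

Theorem theorem3p9 (R : realType) :
  [/\ equivalent_assuming_E2 (@closed_selection R) (@usco_maximiser R),
      equivalent_assuming_E2 (@usco_maximiser R) (@cantor_intersection R) &
      equivalent_assuming_E2 (@closed_selection R) (@cantor_intersection R)] /\
  computes_assuming_E2 (@cantor_intersection R) (@weak_cantor_realiser R).
Proof.
split; last exact: cantor_weak_cantor.
split; split.
- exact: closed_selection_usco.
- exact: usco_closed_selection.
- exact: usco_cantor.
- exact: cantor_usco.
- exact: closed_selection_cantor.
- exact: cantor_closed_selection.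
Qed.
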